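(* Let $n \geq 3$ be an integer. Then the number of equivalence classes of $P_n$ under $\equiv_S$ is \[ |P_n/\!\equiv_S| = \frac{1}{4}\left[(n-1)! + \begin{cases} \left(\frac{n}{2}+1\right)(n-2)!!, & \text{if $n$ is even;}\\ (n-1)!!, & \text{if $n$ is odd.}\end{cases}\right] \]
   Context: Identify the vertices of the complete graph $K_n$ with $n$ regularly spaced points on a circle, labelled $0,1,\dots,n-1$ in cyclic order (the geometric realization); edges are drawn as line segments. $P_n$ denotes the set of subgraphs of $K_n$ induced by Hamiltonian paths: the subgraph has all $n$ vertices and exactly the edges traversed by the path. Two subgraphs $G_1,G_2$ are similar, $G_1 \equiv_S G_2$, if one is obtained from the other by a rotation or reflection of the regular $n$-gon of vertices, i.e. by applying to the vertex labels a map $x \mapsto \pm x + k \pmod n$. For a positive integer $m$, $m!!$ denotes the product of $m$ with all positive integers less than $m$ of the same parity as $m$. *)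

(* Defs.v *)
From mathcomp Require Import all_boot all_order all_algebra all_fingroup.

Set Implicit Arguments.
Unset Strict Implicit.
Unset Printing Implicit Defensive.

(* A pair (vertex set, edge set); edges are two-element vertex sets. *)
Definition subgraph (n : nat) : finType :=
  ({set 'I_n} * {set {set 'I_n}})%type.

(* The permutation p encodes the Hamiltonian path p 0, p 1, ..., p (n-1). *)
Definition path_subgraph (n : nat) (p : 'S_n) : subgraph n :=
  ([set: 'I_n],
   [set [set p i; p j] | i in 'I_n, j in 'I_n & j == i.+1 :> nat]).

Definition ham_paths (n : nat) : {set subgraph n} :=
  [set path_subgraph p | p : 'S_n].

(* x |-> x + k mod n if r = false, and x |-> - x + k mod n if r = true; the
   existence of x : 'I_n is what guarantees 0 < n. *)
Definition dihedral (n : nat) (r : bool) (k : 'I_n) (x : 'I_n) : 'I_n :=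
  Ordinal (ltn_pmod ((if r then n - x else x) + k)
                    (leq_ltn_trans (leq0n x) (ltn_ord x))).

Definition map_subgraph (n : nat) (f : 'I_n -> 'I_n) (G : subgraph n) :
    subgraph n :=
  (f @: G.1, [set f @: e | e : {set 'I_n} in G.2]).

Definition subgraph_similar (n : nat) : rel (subgraph n) := fun G H =>
  [exists r : bool, exists k : 'I_n, H == map_subgraph (dihedral r k) G].

Definition double_fact (m : nat) : nat :=
  \prod_(1 <= i < m.+1 | odd i == odd m) i.

(* Main.v *)
Require Import Defs.
From mathcomp Require Import all_boot all_order all_algebra all_fingroup.
From mathcomp Require Import cyclic zify ring.

(** Composing a path [p : 'S_n] with a dihedral permutation [d] moves the
    subgraph, and two permutations have the same path subgraph exactly when
    they agree up to the reversal [rho].  The classes are therefore the orbits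
    of [<rho> x D_n] acting on ['S_n] by [p |-> a^-1 p d], and Burnside's lemma
    gives
      [4 n * #classes = n! + #|D_n :&: rho ^: 'S_n| * #|'C[rho]|].
    As [rho] is an involution with at most one fixed point, its centralizer has
    [n!!] ([n] even) or [(n-1)!!] ([n] odd) elements.  The conjugates of [rho]
    in [D_n] are all [n] reflections when [n] is odd; when [n] is even they are
    the [n/2] reflections without fixed point and the rotation by [n/2]. *)

Set Implicit Arguments.
Unset Strict Implicit.
Unset Printing Implicit Defensive.

(** * Counting preliminaries and double factorials *)

(** A section [r] of [f] on its image turns [g \o r] into a bijection between the two images. This
    serves to count similarity classes as orbits. *)
Lemma card_imset_eq_ker (T U V : finType) (f : T -> U) (g : T -> V)
    (A : {set T}) :
  {in A &, forall x y, (f x == f y) = (g x == g y)} ->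
  #|f @: A| = #|g @: A|.
Proof.
move=> fg; case: (set_0Vmem A) => [->|[x0 x0A]]; first by rewrite !imset0 !cards0.
pose r y := odflt x0 [pick x in A | f x == y].
have rP x : x \in A -> r (f x) \in A /\ f (r (f x)) = f x.
  move=> xA; rewrite /r; case: pickP => [z /andP[zA /eqP]//|/(_ x)].
  by rewrite xA eqxx.
have -> : g @: A = (g \o r) @: (f @: A).
  rewrite -imset_comp; apply: eq_in_imset => x xA /=.
  have [rA fr] := rP x xA.
  by apply/eqP; rewrite -fg // fr.
rewrite [RHS]card_in_imset // => _ _ /imsetP[x xA ->] /imsetP[y yA ->] /= /eqP.
have [rxA frx] := rP x xA; have [ryA fry] := rP y yA.
by rewrite -fg // frx fry => /eqP.
Qed.

Lemma double_factSS m : double_fact m.+2 = m.+2 * double_fact m.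
Proof.
rewrite /double_fact big_mkcond big_nat_recr //= big_nat_recr //= negbK eqxx.
rewrite mulnC; congr (_ * _)%N.
have -> : (~~ odd m == odd m) = false by case: (odd m).
by rewrite muln1 [RHS]big_mkcond.
Qed.

Lemma double_fact0 : double_fact 0 = 1%N.
Proof. by rewrite /double_fact big_geq. Qed.

(** For even [n], the odd residues index the reflections conjugate to the reversal. *)
Lemma sum_odd n : \sum_(k < n) odd k = n./2.
Proof.
elim: n => [|n IHn]; first by rewrite big_ord0.
by rewrite big_ord_recr /= IHn uphalf_half addnC.
Qed.

Local Open Scope group_scope.

(** * Order of the centralizer of an involution *)

Section InvolutionCentralizer.

Variables (T : finType) (s : {perm T}).
Hypothesis ss1 : s * s = 1.

Let sK x : s (s x) = x.
Proof. by rewrite -permM ss1 perm1. Qed.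

(** Restricting the support to [A] lets an induction discard one pair [x], [s x] at a time. *)
Definition cent_on (A : {set T}) : {set {perm T}} :=
  [set p | perm_on A p & p \in 'C[s]].

Lemma cent_on_group_set A : group_set (cent_on A).
Proof.
apply/group_setP; split=> [|p q]; first by rewrite inE perm_on1 group1.
move=> /setIdP[pA pC] /setIdP[qA qC].
by apply/setIdP; rewrite perm_onM ?groupM.
Qed.
Canonical cent_on_group A := group (cent_on_group_set A).

(** If [y] is [s x], the transposition of the pair commutes with [s]. Otherwise [x], [y], [s x],
    [s y] are distinct, and conjugation by [s] exchanges the two commuting transpositions
    [tperm x y] and [tperm (s x) (s y)]. *)
Lemma cent_on_trans (A : {set T}) x y :
    (forall z, z \in A -> s z \in A) -> (forall z, z \in A -> s z != z) ->
    x \in A -> y \in A ->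
  exists2 p, p \in cent_on A & p x = y.
Proof.
move=> sA sF xA yA.
have tA u v : u \in A -> v \in A -> perm_on A (tperm u v).
  move=> uA vA; apply/subsetP=> z; rewrite inE.
  by case: tpermP => [->|->|]; rewrite ?eqxx.
have [->|yNx] := eqVneq y x; first by exists 1; rewrite ?group1 ?perm1.
have [->|yNsx] := eqVneq y (s x).
  exists (tperm x (s x)); last by rewrite tpermL.
  rewrite inE tA ?sA //=; apply/cent1P/commgP/conjg_fixP.
  by rewrite tpermJ sK tpermC.
exists (tperm x y * tperm (s x) (s y)); last first.
  by rewrite permM tpermL tpermD ?sF // eq_sym.
rewrite inE perm_onM ?tA ?sA //=; apply/cent1P/commgP/conjg_fixP.
rewrite conjMg !tpermJ !sK; apply/commgP/conjg_fixP; rewrite tpermJ.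
have sxsy : s x != y by rewrite eq_sym.
have sysx : s y != x by rewrite -[x]sK (inj_eq perm_inj).
by rewrite !tpermD // eq_sym ?sF.
Qed.

(** Orbit-stabilizer at a point [x] of [A]: the orbit is all of [A], and the stabilizer is the same
    group for [A] without [x] and [s x], whence the recursion of the double factorial. *)
Lemma card_cent_on (A : {set T}) :
    (forall z, z \in A -> s z \in A) -> (forall z, z \in A -> s z != z) ->
  #|cent_on A| = double_fact #|A|.
Proof.
have [m] := ubnP #|A|; elim: m A => // m IHm A leAm sA sF.
have [A0|[x xA]] := set_0Vmem A.
  rewrite A0 cards0 double_fact0; apply/eqP/cards1P; exists 1.
  apply/setP=> p; apply/setIdP/set1P => [[/subsetP p0 _]|->].
    apply/permP=> x; rewrite perm1; apply/eqP/negPn/negP=> px.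
    by have := p0 x px; rewrite inE.
  by rewrite perm_on1 group1.
pose B := A :\ x :\ s x.
have cA : #|A| = #|B|.+2.
  by rewrite (cardsD1 x) xA (cardsD1 (s x)) !inE sA ?sF.
have sB z : z \in B -> s z \in B.
  rewrite !inE => /and3P[zsx zx zA].
  by rewrite (inj_eq perm_inj) zx sA // andbT -[x]sK (inj_eq perm_inj).
have := card_orbit_stab 'P (cent_on_group A) x.
have -> : orbit 'P (cent_on A) x = A.
  apply/setP=> y; apply/orbitP/idP => [[p]|yA].
    by rewrite inE => /andP[pA _] <-; rewrite /= apermE perm_closed.
  by have [p pC px] := cent_on_trans sA sF xA yA; exists p.
have -> : 'C_(cent_on A)[x | 'P] = cent_on B.
  apply/setP=> p; apply/setIP/setIdP => [[/setIdP[pA pC] /astab1P px]|[pB pC]].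
    rewrite /= apermE in px; split=> //; apply/subsetP=> z; rewrite !inE => pz.
    (* A permutation that commutes with [s] and fixes [x] also fixes [s x]. *)
    rewrite (subsetP pA) // andbT; apply/andP; split; apply: contraNneq pz => ->.
      by rewrite -permM -(cent1P pC) permM px.
    by rewrite px.
  split; first apply/setIdP; first split=> //.
    by apply: subset_trans pB _; rewrite /B setDDl subsetDl.
  by apply/astab1P; rewrite /= apermE (out_perm pB) // !inE eqxx andbF.
rewrite (IHm B) // => [<-||]; first by rewrite cA double_factSS.
  by rewrite -ltnS (leq_trans _ leAm) ?cA.
by move=> z; rewrite !inE => /and3P[_ _]; apply: sF.
Qed.

(** The centralizer preserves the fixed-point set of [s]; having at most one element, that set is
    fixed pointwise, so the support lies in its complement. *)
Lemma card_cent1_involution :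
    #|[set x | s x == x]| <= 1 ->
  #|'C[s]| = double_fact (#|T| - #|[set x | s x == x]|).
Proof.
move=> /card_le1_eqP fix1.
rewrite -[[set x | _]]setCK -cardsCs -card_cent_on.
- apply: eq_card => p; rewrite [RHS]in_set andb_idl // => pC.
  apply/subsetP=> x; rewrite !inE; apply: contra => /eqP sx.
  apply/eqP/fix1; rewrite inE ?sx //.
  by rewrite -permM (cent1P pC) permM sx.
- by move=> z; rewrite !inE (inj_eq perm_inj).
by move=> z; rewrite !inE.
Qed.

End InvolutionCentralizer.

(** * Burnside's lemma for two-sided multiplication *)

Section TwoSidedAction.

Variable gT : finGroupType.
Implicit Types (G H : {group gT}) (p : gT).

Definition two_sided p (ab : gT * gT) := ab.1^-1 * p * ab.2.

Lemma two_sided1 : two_sided^~ 1 =1 id.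
Proof. by move=> p; rewrite /two_sided /= invg1 mul1g mulg1. Qed.

Lemma two_sidedM p : act_morph two_sided p.
Proof. by move=> [a b] [c d]; rewrite /two_sided /= invMg !mulgA. Qed.

Definition two_sided_action := TotalAction two_sided1 two_sidedM.

(** The solutions form the coset ['C[a] :* g] of any one solution [g], or there are none. *)
Lemma card_conj_eq (a b : gT) :
  #|[set p | a ^ p == b]| = ((b \in a ^: [set: gT]) * #|'C[a]|)%N.
Proof.
have [/imsetP[g _ ->]|bNa] := boolP (b \in _); last first.
  rewrite mul0n; apply/eqP; rewrite cards_eq0; apply/eqP/setP=> p.
  by rewrite !inE; apply/negbTE; apply: contra bNa => /eqP <-; rewrite memJ_class ?inE.
rewrite mul1n -(card_rcoset _ g); apply: eq_card => p; rewrite inE mem_rcoset.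
rewrite -[p in LHS](mulgKV g) conjgM (inj_eq (conjg_inj g)).
by apply/eqP/cent1P => [/conjg_fixP/commgP|/commute_sym/commgP/conjg_fixP] //; apply: commute_sym.
Qed.

(** Burnside's lemma: [(a, b)] fixes [p] exactly when [a ^ p = b], so [card_conj_eq] counts the
    fixed points. *)
Lemma card_two_sided_orbits G H :
  (#|[set orbit two_sided_action (setX G H) p | p in [set: gT]]| *
     (#|G| * #|H|) =
   \sum_(a in G) #|H :&: a ^: [set: gT]| * #|'C[a]|)%N.
Proof.
rewrite -cardsX -Frobenius_Cauchy; last first.
  by apply/actsP=> c _ p; rewrite !inE.
transitivity (\sum_(a in G) \sum_(b in H) #|[set p | a ^ p == b]%g|)%N.
  rewrite pair_big; apply: eq_big => [[a b]|[a b] _]; first by rewrite in_setX.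
  apply: eq_card => p; rewrite !inE sub1set inE /= /two_sided /=.
  rewrite conjgE; apply/eqP/eqP => [E|<-]; last by rewrite -mulgA mulKVg mulKg.
  by rewrite -{2}E -!mulgA mulKVg mulKg.
apply: eq_bigr => a _; under eq_bigr do rewrite card_conj_eq.
rewrite -big_distrl /=; congr (_ * _)%N.
rewrite -sum1_card big_mkcond [RHS]big_mkcond; apply: eq_bigr => b _ /=.
by rewrite in_setI; case: (b \in H); case: (b \in _).
Qed.

End TwoSidedAction.

(** * Permutations with the same path subgraph *)

Section HamiltonianPaths.

Variable n : nat.
Implicit Types p q : 'S_n.

Definition revp : 'S_n := perm (@rev_ord_inj n).

Lemma revpE (i : 'I_n) : revp i = rev_ord i.
Proof. by rewrite permE. Qed.

Lemma revp2 : revp * revp = 1.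
Proof. by apply/permP=> i; rewrite permM !revpE rev_ordK perm1. Qed.

Lemma edgeP p (e : {set 'I_n}) :
  reflect (exists i j : 'I_n, j = i.+1 :> nat /\ e = [set p i; p j])
          (e \in (path_subgraph p).2).
Proof.
apply: (iffP imset2P) => [[i j _ /[!inE] /eqP ij ->]|[i [j [ij ->]]]].
  by exists i, j.
by exists i j; rewrite ?inE ?ij ?eqxx.
Qed.

Lemma path_subgraphM (f : 'I_n -> 'I_n) p q :
  f =1 q -> map_subgraph f (path_subgraph p) = path_subgraph (p * q).
Proof.
move=> fq; congr (_, _) => /=.
  rewrite (eq_imset _ fq); apply/setP=> x; rewrite inE; apply/imsetP.
  by exists (q^-1 x); rewrite ?permKV.
have im2 i j : f @: [set p i; p j] = [set (p * q) i; (p * q) j].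
  by rewrite imsetU1 imset_set1 !fq !permM.
apply/setP=> e; apply/imsetP/edgeP => [[_ /edgeP[i [j [ij ->]]] ->]|[i [j [ij ->]]]].
  by exists i, j; rewrite im2.
by exists [set p i; p j]; rewrite ?im2 //; apply/edgeP; exists i, j.
Qed.

Lemma path_subgraph_revp p : path_subgraph (revp * p) = path_subgraph p.
Proof.
congr (_, _); apply/setP=> e; apply/edgeP/edgeP=> -[i [j [ij ->]]];
  exists (rev_ord j), (rev_ord i); rewrite ?permM ?revpE ?rev_ordK setUC; split=> //=;
  have := ltn_ord j; lia.
Qed.

(* An injective walk with unit steps cannot turn back. *)
Lemma nat_unit_steps (g : nat -> nat) m :
    (forall i, i <= m -> g i <= m) ->
    (forall i j, i <= m -> j <= m -> g i = g j -> i = j) ->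
    (forall i, i < m -> g i.+1 = (g i).+1 \/ g i = (g i.+1).+1) ->
  (forall i, i <= m -> g i = i) \/ (forall i, i <= m -> g i = m - i).
Proof.
move=> gm ginj gstep; case: m => [|m] in gm ginj gstep *.
  by left=> i; rewrite leqn0 => /eqP->; have := gm 0 isT; lia.
have [up|down] := gstep 0 isT.
  have H i : i <= m -> g i = g 0 + i /\ g i.+1 = g 0 + i.+1.
    elim: i => [|i IHi] im; first by lia.
    have [|e1 e2] := IHi; first lia.
    split=> //; case: (gstep i.+1 im) => e3; first lia.
    by have := ginj i.+2 i; lia.
  (* A climb of [m.+1] unit steps under the bound [m.+1] must start at 0; the descent below must
     likewise start at [m.+1]. *)
  have := H m (leqnn _); have := gm m.+1 (leqnn _) => h1 h2.
  left=> -[|i] im; first lia.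
  by have := H i im; lia.
have H i : i <= m -> g i + i = g 0 /\ g i.+1 + i.+1 = g 0.
  elim: i => [|i IHi] im; first by lia.
  have [|e1 e2] := IHi; first lia.
  split=> //; case: (gstep i.+1 im) => e3; last lia.
  by have := ginj i.+2 i; lia.
have := H m (leqnn _); have := gm 0 isT => h1 h2.
right=> -[|i] im; first lia.
by have := H i im; lia.
Qed.

(** The map [s] sends a position along [q] to the position of the same vertex along [p]. Edges of
    [q] are edges of [p], so [s] takes unit steps and is the identity or the reversal. *)
Lemma path_subgraph_inj p q :
  path_subgraph p = path_subgraph q -> q = p \/ q = revp * p.
Proof.
case: (posnP n) => [n0|n_gt0] epq.
  by left; apply/permP=> i; have := ltn_ord i; rewrite {2}n0.
pose s := q * p^-1.
have step (i j : 'I_n) : j = i.+1 :> nat -> s j = (s i).+1 :> nat \/ s i = (s j).+1 :> nat.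
  move=> ij; have : [set q i; q j] \in (path_subgraph p).2.
    by rewrite epq; apply/edgeP; exists i, j.
  case/edgeP=> k [l [kl /setP E]].
  have qp x : q x = p (s x) by rewrite permM permKV.
  have ss : s i != s j by rewrite (inj_eq perm_inj) -val_eqE /= ij; lia.
  (* Both [s i] and [s j] lie in [{k, l}] and they differ, so they are consecutive. *)
  have := E (q i); have := E (q j).
  rewrite !inE !qp !(inj_eq perm_inj) !eqxx ?orbT /= => /esym/orP ej /esym/orP ei.
  case: ei ej ss => /eqP-> [] /eqP->; rewrite ?eqxx // => _; [left|right]; lia.
(* The default 0 applies only from [n] on, outside the range [i <= n.-1] used below. *)
pose g i := if insub i is Some x then val (s x) else 0.
have gE (x : 'I_n) : g x = s x by rewrite /g valK.
have := @nat_unit_steps g n.-1.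
have lt_n i : i <= n.-1 -> i < n by lia.
case.
- by move=> i /lt_n lti; have := gE (Ordinal lti) => /= ->; rewrite -ltnS prednK.
- move=> i j /lt_n lti /lt_n ltj; have := gE (Ordinal lti) => /= ->.
  by have := gE (Ordinal ltj) => /= -> /val_inj/perm_inj[].
- move=> i lti; have lti1 : i.+1 < n by lia.
  have := gE (Ordinal lti1) => /= ->; have := gE (Ordinal (ltnW lti1)) => /= ->.
  exact: step.
- move=> gi; left; apply/eqP; rewrite eq_mulgV1; apply/eqP/permP=> x.
  by apply: val_inj; rewrite /= -gE gi ?perm1 //; have := ltn_ord x; lia.
move=> gi; right; apply/(mulIg p^-1); rewrite mulgK; apply/permP=> x.
by apply: val_inj; rewrite /= -gE gi ?revpE /=; have := ltn_ord x; lia.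
Qed.

Lemma path_subgraph_eq p q :
  (path_subgraph p == path_subgraph q) = (q == p) || (q == revp * p).
Proof.
apply/eqP/orP => [/path_subgraph_inj[->|->]|[/eqP->|/eqP->]]; rewrite ?eqxx //.
- by left.
- by right.
by rewrite path_subgraph_revp.
Qed.

End HamiltonianPaths.

(** * The dihedral group and the conjugates of the reversal in it *)

Section Dihedral.

Variable m : nat.
(** This form gives ['I_n] the ring structure of the integers modulo [n], with [1] and [-1]
    distinct. *)
Local Notation n := m.+3.
Implicit Types (r : bool) (k x : 'I_n).

Lemma dihedralE r k x : dihedral r k x = ((if r then - x else x) + k)%R.
Proof. by apply: val_inj; case: r => //=; rewrite modnDml. Qed.

Lemma dihedral_inj r k : injective (@dihedral n r k).
Proof.
by move=> x y; rewrite !dihedralE => /GRing.addIr; case: r => // /GRing.oppr_inj.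
Qed.

Definition dih r k : 'S_n := perm (@dihedral_inj r k).

Lemma dihE r k x : dih r k x = ((if r then - x else x) + k)%R.
Proof. by rewrite permE dihedralE. Qed.

Lemma dihM r k r' k' :
  dih r k * dih r' k' = dih (r (+) r') ((if r' then - k else k) + k')%R.
Proof. by apply/permP=> x; rewrite permM !dihE; case: r; case: r' => /=; ring. Qed.

Lemma dih1 : dih false 0%R = 1.
Proof. by apply/permP=> x; rewrite dihE perm1 GRing.addr0. Qed.

Definition dihs : {set 'S_n} := [set dih rk.1 rk.2 | rk : bool * 'I_n].

Lemma mem_dihs r k : dih r k \in dihs.
Proof. by apply/imsetP; exists (r, k). Qed.

Lemma dihs_group_set : group_set dihs.
Proof.
apply/group_setP; split=> [|_ _ /imsetP[[r k] _ ->] /imsetP[[r' k'] _ ->]].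
  by rewrite -dih1 mem_dihs.
by rewrite dihM mem_dihs.
Qed.
Canonical dihs_group := group dihs_group_set.

(** The value at 0 recovers [k]; the value at 1 then recovers [r], because [n] is at least 3. *)
Lemma dih_inj : injective (fun rk => dih rk.1 rk.2).
Proof.
move=> [r k] [r' k'] /= /permP E.
have := E 0%R; rewrite !dihE !GRing.oppr0 !if_same !GRing.add0r => kk.
rewrite {}kk in E *; congr (_, _).
have := E 1%R; rewrite !dihE => /GRing.addIr.
by case: r {E}; case: r' => // /(congr1 val); rewrite /= !modn_small.
Qed.

Lemma card_dihs : #|dihs| = n.*2.
Proof.
by rewrite card_imset ?card_prod ?card_bool ?card_ord ?mul2n //; exact: dih_inj.
Qed.

(** As a reflection, the reversal can be conjugated by rotations through arithmetic modulo [n]. *)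
Lemma revp_dih : revp n = dih true (-1)%R.
Proof.
apply/permP=> x; rewrite revpE dihE; apply: val_inj.
have E : val (-1 : 'I_n)%R = m.+2 by rewrite /= modn_small.
rewrite -[RHS]/(((n - x) %% n + val (-1 : 'I_n)%R) %% n)%N E modnDml /=.
have -> : (n - x + m.+2 = n - x.+1 + n)%N by have := ltn_ord x; lia.
by rewrite modnDr modn_small //; lia.
Qed.

Lemma revp_neq1 : revp n != 1.
Proof.
apply/eqP=> /permP/(_ ord0); rewrite revpE perm1 => /(congr1 val) /=.
by rewrite subn1.
Qed.

Lemma cycle_revp : <[revp n]> = [set 1; revp n].
Proof.
by apply/cycle2g/nt_prime_order; rewrite ?revp_neq1 // expgS expg1 revp2.
Qed.

Lemma card_cycle_revp : #|<[revp n]>| = 2.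
Proof. by rewrite cycle_revp cards2 eq_sym revp_neq1. Qed.

(** The left factor absorbs the two directions in which a path can be read; the right factor carries
    the symmetry of the polygon. *)
Lemma similar_path p q :
  subgraph_similar (path_subgraph p) (path_subgraph q) =
  (q \in orbit (two_sided_action _) (setX <[revp n]> dihs) p).
Proof.
have simP r k : reflect
    (path_subgraph q = map_subgraph (dihedral r k) (path_subgraph p))
    ((p * dih r k == q) || (p * dih r k == revp n * q)).
  rewrite (@path_subgraphM _ _ _ (dih r k)) => [|x]; last by rewrite permE.
  by rewrite -path_subgraph_eq; apply: eqP.
apply/existsP/orbitP => [[r /existsP[k /eqP/(simP r k)]]|[[a b] /setXP[aC /imsetP[[r k] _ ->]] E]].
  move=> /orP[] /eqP pq.
    by exists (1, dih r k); rewrite ?in_setX ?group1 ?mem_dihs //= /two_sided invg1 mul1g.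
  exists (revp n, dih r k); rewrite ?in_setX ?cycle_id ?mem_dihs //=.
  by rewrite /two_sided -mulgA pq mulKg.
exists r; apply/existsP; exists k; apply/eqP/(simP r k); rewrite -E /= /two_sided /=.
move: aC; rewrite cycle_revp => /set2P[->|->]; first by rewrite invg1 mul1g eqxx.
by rewrite -[_ * p * _]mulgA mulKVg eqxx orbT.
Qed.

(** Both families are images of ['S_n], and by [similar_path] the two maps identify the same
    permutations. *)
Lemma card_similarity_classes :
  #|equivalence_partition (@subgraph_similar n) (ham_paths n)| =
  #|[set orbit (two_sided_action _) (setX <[revp n]> dihs) p | p in [set: 'S_n]]|.
Proof.
have -> : ham_paths n = @path_subgraph n @: [set: 'S_n].
  by apply/setP=> G; apply/imsetP/imsetP => -[p _ ->]; exists p; rewrite ?inE.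
rewrite /equivalence_partition -imset_comp.
apply: card_imset_eq_ker => p q _ _ /=.
apply/eqP/eqP => [/setP/(_ (path_subgraph q))|/setP E].
  rewrite !in_set imset_f ?in_setT // !andTb !similar_path orbit_refl.
  by move/orbit_eqP.
apply/setP=> G; rewrite !in_set.
apply: andb_id2l => /imsetP[z _ ->]; rewrite !similar_path; exact: E.
Qed.

Lemma revp_fixE x : (revp n x == x) = (x + x.+1 == n).
Proof. by rewrite revpE -val_eqE /=; have := ltn_ord x; lia. Qed.

Lemma card_revp_fix : #|[set x | revp n x == x]| = odd n.
Proof.
have [n_odd|n_even] := boolP (odd n).
  apply/eqP/cards1P; exists (inord n./2); apply/setP=> x.
  by rewrite inE in_set1 revp_fixE -val_eqE /= inordK; lia.
by apply: eq_card0 => x; rewrite !inE revp_fixE; lia.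
Qed.

Lemma revp_conj_rot k : revp n ^ dih false k = dih true (k + k - 1)%R.
Proof.
apply/(mulgI (dih false k)); rewrite -conjgC revp_dih !dihM; congr dih => /=.
by ring.
Qed.

Lemma refl_class k :
  (dih true k \in revp n ^: [set: 'S_n]) = odd n || odd k.
Proof.
apply/imsetP/idP => [[g _ E]|odd_nk].
  apply: contraT; rewrite negb_or => /andP[n_even k_even].
  (* For [n] and [k] even, the reflection fixes [k / 2], whereas the reversal has no fixed point. *)
  pose x : 'I_n := inord k./2.
  have xx : (x + x = k)%R.
    by apply: val_inj; rewrite /= inordK ?modn_small; have := ltn_ord k; lia.
  have : dih true k x = x by rewrite dihE -xx; ring.
  rewrite E -[x in X in X = _](permKV g) permJ => /(congr1 g^-1); rewrite permK.
  by move/eqP; rewrite revp_fixE; lia.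
(* By [revp_conj_rot], [j] has to solve [2 j = k + 1] modulo [n]; when [k] is even, [n] is odd and
   adding it permits halving. *)
pose j : 'I_n := inZp (if odd k then k.+1./2 else (k.+1 + n)./2).
exists (dih false j); rewrite ?inE // revp_conj_rot; congr dih.
apply/eqP; rewrite eq_sym GRing.subr_eq; apply/eqP/val_inj.
rewrite /= modnDm [in RHS](@modn_small 1) // addn1; case: ifP odd_nk => k_odd odd_nk.
  by congr (_ %% _)%N; lia.
rewrite -[RHS]modnDr; congr (_ %% _)%N.
lia.
Qed.

Lemma rot_class k :
  (dih false k \in revp n ^: [set: 'S_n]) = (k + k == n)%N.
Proof.
apply/imsetP/eqP => [[g _ E]|kk].
  have : dih false k * dih false k = 1 by rewrite E -conjMg revp2 conj1g.
  rewrite dihM -dih1 => /(@dih_inj (_, _) (_, _))/(congr1 snd)/(congr1 val) /= kk.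
  have k0 : k != ord0.
    apply: contra_eq_neq E => ->; rewrite dih1 -(conj1g g) (inj_eq (conjg_inj g)).
    by rewrite eq_sym revp_neq1.
  have k_gt0 : 0 < k by rewrite lt0n.
  (* As [0 < 2 k < 2 n], the quotient can only be 1. *)
  have := divn_eq (k + k) n; rewrite kk addn0.
  by have := ltn_ord k; case: (_ %/ _) => [|[|d]]; lia.
(* [f] sends the pairs {i, n-1-i} swapped by the reversal to the pairs
   {i, i + n/2} swapped by the half turn. *)
pose f (i : 'I_n) : 'I_n := inord (if i < k then i : nat else n - i.+1 + k).
have fE i : f i = (if i < k then i : nat else n - i.+1 + k) :> nat.
  by rewrite inordK //; have := ltn_ord i; case: ifP; lia.
have f_inj : injective f.
  move=> i j /(congr1 val) /=; rewrite !fE => E; apply: val_inj => /=; move: E.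
  by have := ltn_ord i; have := ltn_ord j; case: ifP; case: ifP; lia.
exists (perm f_inj); rewrite ?inE //; apply/(mulgI (perm f_inj)); rewrite -conjgC.
apply/permP=> i; rewrite !permM dihE !permE; apply: val_inj; rewrite /= !fE /=.
have [ik|ki] := ltnP i k.
  rewrite modn_small; last by lia.
  by case: ifP; lia.
have -> : (n - i.+1 + k + k = n - i.+1 + n)%N by lia.
rewrite modnDr modn_small; last by lia.
by case: ifP; lia.
Qed.

Lemma sum_double_eq : \sum_(k < n) (k + k == n) = ~~ odd n.
Proof.
have [n_odd|n_even] := boolP (odd n).
  by rewrite big1 // => k _; apply/eqP; rewrite eqb0; lia.
rewrite (bigD1 (inord n./2)) //= big1 ?addn0; last first.
  by move=> k; rewrite -val_eqE /= inordK => *; apply/eqP; rewrite ?eqb0; lia.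
by rewrite inordK; lia.
Qed.

Lemma card_dihs_class :
  #|dihs :&: revp n ^: [set: 'S_n]| = if odd n then n else (n./2).+1.
Proof.
have -> : dihs :&: revp n ^: [set: 'S_n] =
    (fun rk => dih rk.1 rk.2) @: [set rk | dih rk.1 rk.2 \in revp n ^: [set: 'S_n]].
  apply/setP=> p; apply/setIP/imsetP => [[/imsetP[rk _ ->] pC]|[rk + ->]].
    by exists rk; rewrite ?inE.
  by rewrite inE mem_dihs.
rewrite card_imset; last exact: dih_inj.
rewrite -sum1dep_card big_mkcond /=.
rewrite -(pair_bigA _ (fun r k => if dih r k \in _ then 1 else 0)%N) /= big_bool /=.
under eq_bigr do rewrite refl_class.
under [X in (_ + X)%N]eq_bigr do rewrite rot_class.
have -> : (\sum_(k < n) (if k + k == n then 1 else 0) = ~~ odd n)%N.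
  by rewrite -sum_double_eq; apply: eq_bigr => k _; case: (_ == _).
rewrite -[RHS]/(if odd n then n else n./2.+1).
have [n_odd|n_even] := boolP (odd n).
  by rewrite big_const_ord iter_addn_0 mul1n addn0.
by rewrite addn1 -(sum_odd n).
Qed.

Lemma card_similarity_classes_mul :
  (#|equivalence_partition (@subgraph_similar n) (ham_paths n)| * (4 * n) =
   n`! + (if odd n then n else (n./2).+1) * double_fact (n - odd n))%N.
Proof.
rewrite card_similarity_classes.
have -> : (4 * n = #|<[revp n]>| * #|dihs|)%N.
  by rewrite card_cycle_revp card_dihs; lia.
rewrite (card_two_sided_orbits <[revp n]>%G dihs_group) /= cycle_revp.
(* The identity contributes the factorial term, the reversal the double factorial term. *)
rewrite big_setU1 ?inE 1?eq_sym ?revp_neq1 //= big_set1 card_dihs_class.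
rewrite class1G (setIidPr (sub1G _)) cards1 mul1n cent11T cardsT card_Sn.
by rewrite (card_cent1_involution (revp2 n)) ?card_revp_fix ?leq_b1 // card_ord.
Qed.

End Dihedral.

(** * Division by [4 n] over the rationals *)

Local Open Scope ring_scope.

Theorem theorem6 (n : nat) (hn : (3 <= n)%N) :
  #|equivalence_partition (@subgraph_similar n) (ham_paths n)|%:R =
  1 / 4 * (((n - 1)`!)%N%:R +
           (if odd n then (double_fact (n - 1)%N)%:R
            else (n%:R / 2 + 1) * (double_fact (n - 2)%N)%:R)) :> rat.
Proof.
have := @card_similarity_classes_mul (n - 3).
have -> : (n - 3).+3 = n by lia.
move=> /(congr1 (fun a => a%:R : rat)).
have n0 : n%:R != 0 :> rat by rewrite Num.Theory.pnatr_eq0; lia.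
have -> : n`! = (n * (n - 1)`!)%N by case: (n) hn => // k _; rewrite subn1 factS.
rewrite !(GRing.natrM, GRing.natrD).
set N := _%:R : rat; set F := _`!%:R : rat.
case: ifPn => [n_odd|n_even] E; apply: (GRing.mulIf n0).
  have {}E : N * n%:R = (n%:R * F + n%:R * (double_fact (n - 1))%:R) / 4.
    by rewrite -E; field.
  by rewrite E; field.
(* Here [false] is the value of [odd n]; pulling [n] out of the double factorial allows its
   cancellation. *)
have dn : double_fact (n - false) = (n * double_fact (n - 2))%N.
  by case: (n) hn => [|[|k]] // _; rewrite subn0 double_factSS subSS subSS subn0.
have hn2 : (n./2)%:R = n%:R / 2 :> rat.
  by rewrite -[in RHS](even_halfK n_even) -muln2 GRing.natrM GRing.mulfK.
have {}E : N * n%:R = (n%:R * F + (n%:R / 2 + 1) * (n%:R * (double_fact (n - 2))%:R)) / 4.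
  by rewrite -GRing.natrM -dn -hn2 GRing.natr1 -E; field.
by rewrite E; field.
Qed.
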